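(* Let $(\mathfrak g,[\cdot,\cdot,\cdot],\alpha,\beta)$ and $(\mathfrak g',[\cdot,\cdot,\cdot]',\alpha',\beta')$ be two 3-Bihom-Lie superalgebras over a field $\mathbb K$. Define on $\mathfrak g\oplus\mathfrak g'$ the trilinear map $$[u_1+v_1,u_2+v_2,u_3+v_3]_{\mathfrak g\oplus\mathfrak g'}=[u_1,u_2,u_3]+[v_1,v_2,v_3]'\qquad(u_i\in\mathfrak g,\ v_i\in\mathfrak g')$$ and the linear maps $(\alpha+\alpha')(u+v)=\alpha(u)+\alpha'(v)$, $(\beta+\beta')(u+v)=\beta(u)+\beta'(v)$ for $u\in\mathfrak g$, $v\in\mathfrak g'$. Then $(\mathfrak g\oplus\mathfrak g',[\cdot,\cdot,\cdot]_{\mathfrak g\oplus\mathfrak g'},\alpha+\alpha',\beta+\beta')$ is a 3-Bihom-Lie superalgebra.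
   Context: The direct sum is graded by $(\mathfrak g\oplus\mathfrak g')_i=\mathfrak g_i\oplus\mathfrak g'_i$, $i\in\mathbb Z_2$. For a homogeneous element $x$, $|x|\in\mathbb Z_2$ denotes its degree; identities involving $|x|$ are for homogeneous elements. A 3-Bihom-Lie superalgebra over $\mathbb K$ is a quadruple $(\mathfrak g,[\cdot,\cdot,\cdot],\alpha,\beta)$ consisting of a $\mathbb Z_2$-graded vector space $\mathfrak g=\mathfrak g_0\oplus\mathfrak g_1$, an even trilinear map $[\cdot,\cdot,\cdot]:\mathfrak g\times\mathfrak g\times\mathfrak g\to\mathfrak g$ and two even linear maps $\alpha,\beta:\mathfrak g\to\mathfrak g$ such that for all $x,y,z,u,v\in\mathfrak g$: (1) $\alpha\circ\beta=\beta\circ\alpha$; (2) $\alpha([x,y,z])=[\alpha(x),\alpha(y),\alpha(z)]$ and $\beta([x,y,z])=[\beta(x),\beta(y),\beta(z)]$; (3) $[\beta(x),\beta(y),\alpha(z)]=-(-1)^{|x||y|}[\beta(y),\beta(x),\alpha(z)]=-(-1)^{|y||z|}[\beta(x),\beta(z),\alpha(y)]$; (4) $[\beta^2(x),\beta^2(y),[\beta(z),\beta(u),\alpha(v)]]=(-1)^{(|u|+|v|)(|x|+|y|+|z|)}[\beta^2(u),\beta^2(v),[\beta(x),\beta(y),\alpha(z)]]-(-1)^{(|z|+|v|)(|x|+|y|)+|u||v|}[\beta^2(z),\beta^2(v),[\beta(x),\beta(y),\alpha(u)]]+(-1)^{(|z|+|u|)(|x|+|y|)}[\beta^2(z),\beta^2(u),[\beta(x),\beta(y),\alpha(v)]]$.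 *)

(* Defs.v *)
From mathcomp Require Import all_boot all_order all_algebra.

Set Implicit Arguments.
Unset Strict Implicit.
Unset Printing Implicit Defensive.

Import GRing.Theory.
Local Open Scope ring_scope.

(* Internal grading V = V_0 (+) V_1 of a space of arbitrary dimension. *)
Record is_Z2_grading (K : fieldType) (V : lmodType K) (V_ : 'Z_2 -> {pred V}) :
    Prop := IsZ2Grading {
  grading_submod : forall i, submod_closed (V_ i);
  grading_span : forall x : V,
    exists x0 x1, [/\ x0 \in V_ 0, x1 \in V_ 1 & x = x0 + x1];
  grading_direct : forall x : V, x \in V_ 0 -> x \in V_ 1 -> x = 0
}.

Definition trilinear (K : fieldType) (V : lmodType K) (br : V -> V -> V -> V) :
    Prop :=
  [/\ forall y z, linear (fun x => br x y z),
      forall x z, linear (fun y => br x y z)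
    & forall x y, linear (fun z => br x y z)].

Definition even_map (K : fieldType) (V : lmodType K) (V_ : 'Z_2 -> {pred V})
    (f : V -> V) : Prop :=
  forall i x, x \in V_ i -> f x \in V_ i.

Definition even_bracket (K : fieldType) (V : lmodType K)
    (V_ : 'Z_2 -> {pred V}) (br : V -> V -> V -> V) : Prop :=
  forall i j k x y z, x \in V_ i -> y \in V_ j -> z \in V_ k ->
    br x y z \in V_ (i + j + k).

(* Identities involving |x| quantify over every degree dx with x in V_dx, so the
   zero vector counts as homogeneous of both degrees.  The exponents of -1 are
   computed in nat from the representatives 0, 1 of the degrees; only their
   parity matters. *)
Definition bihom_skewsym (K : fieldType) (V : lmodType K)
    (V_ : 'Z_2 -> {pred V}) (br : V -> V -> V -> V) (al be : V -> V) : Prop :=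
  forall (dx dy dz : 'Z_2) (x y z : V),
  x \in V_ dx -> y \in V_ dy -> z \in V_ dz ->
  br (be x) (be y) (al z)
    = - ((-1) ^+ (dx * dy) *: br (be y) (be x) (al z)) /\
  br (be x) (be y) (al z)
    = - ((-1) ^+ (dy * dz) *: br (be x) (be z) (al y)).

Definition bihom_jacobi (K : fieldType) (V : lmodType K)
    (V_ : 'Z_2 -> {pred V}) (br : V -> V -> V -> V) (al be : V -> V) : Prop :=
  forall (dx dy dz du dv : 'Z_2) (x y z u v : V),
  x \in V_ dx -> y \in V_ dy -> z \in V_ dz -> u \in V_ du -> v \in V_ dv ->
  br (be (be x)) (be (be y)) (br (be z) (be u) (al v))
    = (-1) ^+ ((du + dv) * (dx + dy + dz)) *:
        br (be (be u)) (be (be v)) (br (be x) (be y) (al z))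
      - (-1) ^+ ((dz + dv) * (dx + dy) + du * dv) *:
        br (be (be z)) (be (be v)) (br (be x) (be y) (al u))
      + (-1) ^+ ((dz + du) * (dx + dy)) *:
        br (be (be z)) (be (be u)) (br (be x) (be y) (al v)).

Record is_3BihomLie_superalgebra (K : fieldType) (V : lmodType K)
    (V_ : 'Z_2 -> {pred V}) (br : V -> V -> V -> V) (al be : V -> V) : Prop :=
  Is3BihomLieSuperalgebra {
  bihom_grading : is_Z2_grading V_;
  bihom_br_trilinear : trilinear br;
  bihom_br_even : even_bracket V_ br;
  bihom_al_linear : linear al;
  bihom_al_even : even_map V_ al;
  bihom_be_linear : linear be;
  bihom_be_even : even_map V_ be;
  bihom_comm : forall x, al (be x) = be (al x);
  bihom_al_mult : forall x y z, al (br x y z) = br (al x) (al y) (al z);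
  bihom_be_mult : forall x y z, be (br x y z) = br (be x) (be y) (be z);
  bihom_br_skew : bihom_skewsym V_ br al be;
  bihom_br_jacobi : bihom_jacobi V_ br al be
}.

(* The direct sum of V and W is the product module V * W; the element u + v of
   the direct sum is the pair (u, v). *)
Definition dsum_grading (K : fieldType) (V W : lmodType K)
    (V_ : 'Z_2 -> {pred V}) (W_ : 'Z_2 -> {pred W}) (i : 'Z_2) :
    {pred (V * W)%type} :=
  [pred w | (w.1 \in V_ i) && (w.2 \in W_ i)].

Definition dsum_bracket (K : fieldType) (V W : lmodType K)
    (br : V -> V -> V -> V) (br' : W -> W -> W -> W) (w1 w2 w3 : V * W) :
    V * W :=
  (br w1.1 w2.1 w3.1, br' w1.2 w2.2 w3.2).

Definition dsum_map (K : fieldType) (V W : lmodType K)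
    (f : V -> V) (f' : W -> W) (w : V * W) : V * W :=
  (f w.1, f' w.2).

(* Main.v *)
Require Import Defs.
From mathcomp Require Import all_boot all_order all_algebra.

(** Every operation on the direct sum acts componentwise, and a pair is homogeneous of degree [i]
    exactly when both of its components are homogeneous of that same degree [i]. Hence a sign
    depending on degrees is common to the two components, and each axiom for pairs is the
    conjunction of the corresponding axioms of the two summands. The signed identities, carried by
    [dsum_bihom_skewsym] and [dsum_bihom_jacobi], are where this sharing of degrees matters. A pair
    such as [(x, 0)] causes no trouble, since zero is homogeneous of both degrees. *)

Lemma dsum_map_linear (K : fieldType) (V W : lmodType K)
  (f : V -> V) (f' : W -> W) :
  linear f -> linear f' -> linear (dsum_map f f').
Proof. by move=> lf lf' a u v; rewrite /dsum_map /= lf lf'. Qed.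

Lemma dsum_map_even (K : fieldType) (V W : lmodType K)
  (V_ : 'Z_2 -> {pred V}) (W_ : 'Z_2 -> {pred W})
  (f : V -> V) (f' : W -> W) :
  even_map V_ f -> even_map W_ f' ->
  even_map (dsum_grading V_ W_) (dsum_map f f').
Proof.
move=> ef ef' i x /andP[x1 x2].
by apply/andP; split; [apply: ef | apply: ef'].
Qed.

Lemma dsum_grading_is_Z2_grading (K : fieldType) (V W : lmodType K)
  (V_ : 'Z_2 -> {pred V}) (W_ : 'Z_2 -> {pred W}) :
  is_Z2_grading V_ -> is_Z2_grading W_ -> is_Z2_grading (dsum_grading V_ W_).
Proof.
move=> [subV spanV dirV] [subW spanW dirW]; split.
- move=> i; have [V0 linV] := subV i; have [W0 linW] := subW i.
  split; first by apply/andP.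
  move=> a u v /andP[u1 u2] /andP[v1 v2].
  by apply/andP; split; [apply: linV | apply: linW].
- move=> [x y]; have [x0 [x1 [x0V x1V ->]]] := spanV x.
  have [y0 [y1 [y0W y1W ->]]] := spanW y.
  (* Regroup by degree: the even parts of the two components form the even part of the pair, and
     likewise for the odd parts. *)
  by exists (x0, y0), (x1, y1); split; [apply/andP | apply/andP |].
- move=> [x y] /andP[x0 y0] /andP[x1 y1].
  (* The zero of the product module unfolds to the pair of zeros, so the goal splits by
     component. *)
  by congr pair; [apply: dirV | apply: dirW].
Qed.

Lemma dsum_bracket_trilinear (K : fieldType) (V W : lmodType K)
  (br : V -> V -> V -> V) (br' : W -> W -> W -> W) :
  trilinear br -> trilinear br' -> trilinear (dsum_bracket br br').
Proof.
move=> [l1 l2 l3] [l1' l2' l3']; split=> p q a u v; rewrite /dsum_bracket /=.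
- by rewrite l1 l1'.
- by rewrite l2 l2'.
- by rewrite l3 l3'.
Qed.

Lemma dsum_bracket_even (K : fieldType) (V W : lmodType K)
  (V_ : 'Z_2 -> {pred V}) (W_ : 'Z_2 -> {pred W})
  (br : V -> V -> V -> V) (br' : W -> W -> W -> W) :
  even_bracket V_ br -> even_bracket W_ br' ->
  even_bracket (dsum_grading V_ W_) (dsum_bracket br br').
Proof.
move=> e e' i j k x y z /andP[x1 x2] /andP[y1 y2] /andP[z1 z2].
by apply/andP; split; [apply: e | apply: e'].
Qed.

(** Both components of a homogeneous pair share its degree, so swapping two arguments produces the
    same sign on each side. *)
Lemma dsum_bihom_skewsym (K : fieldType) (V W : lmodType K)
  (V_ : 'Z_2 -> {pred V}) (W_ : 'Z_2 -> {pred W})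
  (br : V -> V -> V -> V) (br' : W -> W -> W -> W)
  (al be : V -> V) (al' be' : W -> W) :
  bihom_skewsym V_ br al be -> bihom_skewsym W_ br' al' be' ->
  bihom_skewsym (dsum_grading V_ W_) (dsum_bracket br br')
    (dsum_map al al') (dsum_map be be').
Proof.
move=> s s' dx dy dz x y z /andP[x1 x2] /andP[y1 y2] /andP[z1 z2].
have [sxy syz] := s _ _ _ _ _ _ x1 y1 z1.
have [sxy' syz'] := s' _ _ _ _ _ _ x2 y2 z2.
(* Negation and scaling of pairs compute componentwise, so the paired equation is the goal up to
   conversion. *)
by split; [apply: (congr2 pair sxy sxy') | apply: (congr2 pair syz syz')].
Qed.

Lemma dsum_bihom_jacobi (K : fieldType) (V W : lmodType K)
  (V_ : 'Z_2 -> {pred V}) (W_ : 'Z_2 -> {pred W})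
  (br : V -> V -> V -> V) (br' : W -> W -> W -> W)
  (al be : V -> V) (al' be' : W -> W) :
  bihom_jacobi V_ br al be -> bihom_jacobi W_ br' al' be' ->
  bihom_jacobi (dsum_grading V_ W_) (dsum_bracket br br')
    (dsum_map al al') (dsum_map be be').
Proof.
move=> J J' dx dy dz du dv x y z u v.
move=> /andP[x1 x2] /andP[y1 y2] /andP[z1 z2] /andP[u1 u2] /andP[v1 v2].
(* The three signs depend only on [dx], ..., [dv], common to both components; pairing the two
   identities therefore gives the goal by computation. *)
exact: (congr2 pair (J _ _ _ _ _ _ _ _ _ _ x1 y1 z1 u1 v1)
                    (J' _ _ _ _ _ _ _ _ _ _ x2 y2 z2 u2 v2)).
Qed.

Theorem proposition2p15 (K : fieldType) (g g' : lmodType K)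
  (g_ : 'Z_2 -> {pred g}) (g'_ : 'Z_2 -> {pred g'})
  (br : g -> g -> g -> g) (br' : g' -> g' -> g' -> g')
  (al be : g -> g) (al' be' : g' -> g') :
  is_3BihomLie_superalgebra g_ br al be ->
  is_3BihomLie_superalgebra g'_ br' al' be' ->
  is_3BihomLie_superalgebra (dsum_grading g_ g'_) (dsum_bracket br br')
    (dsum_map al al') (dsum_map be be').
Proof.
move=> [gr tri ev all ale bel bee comm alm bem skew jac].
move=> [gr' tri' ev' all' ale' bel' bee' comm' alm' bem' skew' jac'].
split.
- exact: dsum_grading_is_Z2_grading.
- exact: dsum_bracket_trilinear.
- exact: dsum_bracket_even.
- exact: dsum_map_linear.
- exact: dsum_map_even.
- exact: dsum_map_linear.
- exact: dsum_map_even.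
(* The sign-free identities hold for arbitrary elements and are rewritten in each component. *)
- by move=> x; rewrite /dsum_map /= comm comm'.
- by move=> x y z; rewrite /dsum_map /= alm alm'.
- by move=> x y z; rewrite /dsum_map /= bem bem'.
- exact: dsum_bihom_skewsym.
- exact: dsum_bihom_jacobi.
Qed.
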